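(* Let $\pi:\mathbb{R}^n\to\mathbb{R}^m$ be an $\ell$-layer ReLU-activated feedforward neural network and let $\mathcal{X}\subset\mathbb{R}^n$ be a hybrid zonotope (with a given representation $\mathcal{X}=\langle \mathbf{G}^c_x,\mathbf{G}^b_x,\mathbf{c}_x,\mathbf{A}^c_x,\mathbf{A}^b_x,\mathbf{b}_x\rangle$). Let $\mathcal{H}_\pi$ be the output of the Graph Set Algorithm (defined in the context) applied to $\mathcal{X}$ and $\pi$, with scalars $\alpha,\beta>0$ large enough that $\mathcal{Z}^{(k-1)}\subseteq[-\alpha,\beta]^{n_k}$ for every $k=1,\dots,\ell-1$. Then $\mathcal{H}_\pi$ is a hybrid zonotope that exactly represents the graph set of $\pi$ over $\mathcal{X}$, i.e. $$\mathcal{H}_\pi=\mathcal{G}(\pi,\mathcal{X}):=\{(\mathbf{x},\mathbf{u})\in\mathbb{R}^{n+m}\;|\;\mathbf{u}=\pi(\mathbf{x}),\ \mathbf{x}\in\mathcal{X}\}.$$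
   Context: **Hybrid zonotopes.** A set $\mathcal{Z}\subset\mathbb{R}^N$ is a hybrid zonotope (HZ) if there are $\mathbf{c}\in\mathbb{R}^N$, $\mathbf{G}^c\in\mathbb{R}^{N\times n_g}$, $\mathbf{G}^b\in\mathbb{R}^{N\times n_b}$, $\mathbf{A}^c\in\mathbb{R}^{n_c\times n_g}$, $\mathbf{A}^b\in\mathbb{R}^{n_c\times n_b}$, $\mathbf{b}\in\mathbb{R}^{n_c}$ such that $$\mathcal{Z}=\{\mathbf{G}^c\xi^c+\mathbf{G}^b\xi^b+\mathbf{c}\;|\;\xi^c\in[-1,1]^{n_g},\ \xi^b\in\{-1,1\}^{n_b},\ \mathbf{A}^c\xi^c+\mathbf{A}^b\xi^b=\mathbf{b}\};$$ this is written $\mathcal{Z}=\langle\mathbf{G}^c,\mathbf{G}^b,\mathbf{c},\mathbf{A}^c,\mathbf{A}^b,\mathbf{b}\rangle$. The numbers $n_g,n_b,n_c$ may be zero. **Network.** $\pi$ has weights $\mathbf{W}^{(k-1)}\in\mathbb{R}^{n_k\times n_{k-1}}$ and biases $\mathbf{v}^{(k-1)}\in\mathbb{R}^{n_k}$, $k=1,\dots,\ell$, with $n_0=n$, $n_\ell=m$. With $\mathbf{x}^{(0)}=\mathbf{x}$ and $\mathbf{x}^{(k)}=\phi(\mathbf{W}^{(k-1)}\mathbf{x}^{(k-1)}+\mathbf{v}^{(k-1)})$ for $k=1,\dots,\ell-1$, one sets $\pi(\mathbf{x})=\mathbf{W}^{(\ell-1)}\mathbf{x}^{(\ell-1)}+\mathbf{v}^{(\ell-1)}$.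 Here $\phi$ applies $ReLU(z)=\max\{z,0\}$ to each component. **The HZ $\mathcal{H}$.** For $\alpha,\beta>0$, $\mathcal{H}=\langle\mathbf{G}^c_h,\mathbf{G}^b_h,\mathbf{c}_h,\mathbf{A}^c_h,\mathbf{A}^b_h,\mathbf{b}_h\rangle\subset\mathbb{R}^2$ with $$\mathbf{G}^c_h=\begin{bmatrix}\frac{\alpha}{2}&\frac{\beta}{2}&0&0&0&0\\0&\frac{\beta}{2}&0&0&0&0\end{bmatrix},\ \mathbf{G}^b_h=\begin{bmatrix}-\frac{\alpha+\beta}{4}\\-\frac{\beta}{4}\end{bmatrix},\ \mathbf{c}_h=\begin{bmatrix}\frac{\beta-\alpha}{4}\\\frac{\beta}{4}\end{bmatrix},$$ $$\mathbf{A}^c_h=\begin{bmatrix}1&0&1&0&0&0\\-1&0&0&1&0&0\\0&1&0&0&1&0\\0&-1&0&0&0&1\end{bmatrix},\ \mathbf{A}^b_h=\begin{bmatrix}\frac12\\\frac12\\-\frac12\\-\frac12\end{bmatrix},\ \mathbf{b}_h=\begin{bmatrix}\frac12\\\frac12\\\frac12\\\frac12\end{bmatrix}.$$ **Operations on representations.** - Affine map: $\mathbf{W}\langle\mathbf{G}^c,\mathbf{G}^b,\mathbf{c},\mathbf{A}^c,\mathbf{A}^b,\mathbf{b}\rangle+\mathbf{v}=\langle\mathbf{W}\mathbf{G}^c,\mathbf{W}\mathbf{G}^b,\mathbf{W}\mathbf{c}+\mathbf{v},\mathbf{A}^c,\mathbf{A}^b,\mathbf{b}\rangle$. - Cartesian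 power $\mathcal{H}^{N}=\mathcal{H}\times\cdots\times\mathcal{H}$: block-diagonal $\mathbf{G}^c,\mathbf{G}^b,\mathbf{A}^c,\mathbf{A}^b$ and stacked $\mathbf{c},\mathbf{b}$. - Generalized intersection $\mathcal{Y}\cap_{\mathbf{R}}\mathcal{Z}=\{\mathbf{y}\in\mathcal{Y}\;|\;\mathbf{R}\mathbf{y}\in\mathcal{Z}\}$, with the factors of $\mathcal{Z}$ listed first: $$\mathcal{Y}\cap_{\mathbf{R}}\mathcal{Z}=\left\langle[\mathbf{0}\ \mathbf{G}^c_y],[\mathbf{0}\ \mathbf{G}^b_y],\mathbf{c}_y,\begin{bmatrix}\mathbf{A}^c_z&\mathbf{0}\\\mathbf{0}&\mathbf{A}^c_y\\-\mathbf{G}^c_z&\mathbf{R}\mathbf{G}^c_y\end{bmatrix},\begin{bmatrix}\mathbf{A}^b_z&\mathbf{0}\\\mathbf{0}&\mathbf{A}^b_y\\-\mathbf{G}^b_z&\mathbf{R}\mathbf{G}^b_y\end{bmatrix},\begin{bmatrix}\mathbf{b}_z\\\mathbf{b}_y\\\mathbf{c}_z-\mathbf{R}\mathbf{c}_y\end{bmatrix}\right\rangle.$$ **Graph Set Algorithm.** Input: $\mathcal{X}=\langle\mathbf{G}^c_x,\mathbf{G}^b_x,\mathbf{c}_x,\mathbf{A}^c_x,\mathbf{A}^b_x,\mathbf{b}_x\rangle$, $\ell$, the weights and biases, and $\alpha,\beta>0$. Set $\mathcal{X}^{(0)}=\mathcal{X}$. For $k=1,\dots,\ell-1$: (1) $\mathcal{Z}^{(k-1)}=\mathbf{W}^{(k-1)}\mathcal{X}^{(k-1)}+\mathbf{v}^{(k-1)}$;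 (2) $\mathcal{G}^{(k)}=(\mathbf{P}_k\cdot\mathcal{H}^{n_k})\cap_{[\mathbf{I}\ \mathbf{0}]}\mathcal{Z}^{(k-1)}$, where $\mathbf{P}_k=[\mathbf{e}_1\ \mathbf{e}_3\cdots\mathbf{e}_{2n_k-1}\ \mathbf{e}_2\ \mathbf{e}_4\cdots\mathbf{e}_{2n_k}]^T\in\mathbb{R}^{2n_k\times2n_k}$ ($\mathbf{e}_i$ being the $i$-th column of the identity) and $[\mathbf{I}\ \mathbf{0}]\in\mathbb{R}^{n_k\times 2n_k}$; (3) $\mathcal{X}^{(k)}=[\mathbf{0}\ \mathbf{I}]\cdot\mathcal{G}^{(k)}$ with $[\mathbf{0}\ \mathbf{I}]\in\mathbb{R}^{n_k\times2n_k}$. Then set $\mathcal{X}^{(\ell)}=\mathbf{W}^{(\ell-1)}\mathcal{X}^{(\ell-1)}+\mathbf{v}^{(\ell-1)}=:\langle\mathbf{G}^c,\mathbf{G}^b,\mathbf{c},\mathbf{A}^c,\mathbf{A}^b,\mathbf{b}\rangle$ and output $$\mathcal{H}_\pi=\left\langle\begin{bmatrix}[\mathbf{G}^c_x\ \ \mathbf{0}]\\\mathbf{G}^c\end{bmatrix},\begin{bmatrix}[\mathbf{G}^b_x\ \ \mathbf{0}]\\\mathbf{G}^b\end{bmatrix},\begin{bmatrix}\mathbf{c}_x\\\mathbf{c}\end{bmatrix},\mathbf{A}^c,\mathbf{A}^b,\mathbf{b}\right\rangle.$$ *)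

(* Defs.v *)
From HB Require Import structures.
From mathcomp Require Import all_boot all_order all_algebra.
From mathcomp Require Import classical_sets reals.

Set Implicit Arguments.
Unset Strict Implicit.
Unset Printing Implicit Defensive.

Import Order.TTheory GRing.Theory Num.Theory.
Local Open Scope classical_set_scope.
Local Open Scope ring_scope.

(* A representation <Gc, Gb, c, Ac, Ab, b>.  The operations below act on
   representations, not on the sets that these denote. *)
Record hz (R : realType) (N : nat) : Type := HZ {
  hz_ng : nat;
  hz_nb : nat;
  hz_nc : nat;
  hz_Gc : 'M[R]_(N, hz_ng);
  hz_Gb : 'M[R]_(N, hz_nb);
  hz_c : 'cV[R]_N;
  hz_Ac : 'M[R]_(hz_nc, hz_ng);
  hz_Ab : 'M[R]_(hz_nc, hz_nb);
  hz_b : 'cV[R]_hz_nc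
}.

Definition hz_set (R : realType) (N : nat) (Z : hz R N) : set 'cV[R]_N :=
  [set z | exists (xc : 'cV[R]_(hz_ng Z)) (xb : 'cV[R]_(hz_nb Z)),
     [/\ forall i, -1 <= xc i 0 <= 1,
         forall i, xb i 0 = -1 \/ xb i 0 = 1,
         hz_Ac Z *m xc + hz_Ab Z *m xb = hz_b Z
       & z = hz_Gc Z *m xc + hz_Gb Z *m xb + hz_c Z]].

Definition is_hybrid_zonotope (R : realType) (N : nat) (S : set 'cV[R]_N) :
    Prop :=
  exists Z : hz R N, S = hz_set Z.

Definition hz_affine (R : realType) (M N : nat) (W : 'M[R]_(M, N))
    (Z : hz R N) (v : 'cV[R]_M) : hz R M :=
  HZ (W *m hz_Gc Z) (W *m hz_Gb Z) (W *m hz_c Z + v)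
     (hz_Ac Z) (hz_Ab Z) (hz_b Z).

Definition hz_prod (R : realType) (M N : nat) (Y : hz R M) (Z : hz R N) :
    hz R (M + N) :=
  HZ (block_mx (hz_Gc Y) 0 0 (hz_Gc Z)) (block_mx (hz_Gb Y) 0 0 (hz_Gb Z))
     (col_mx (hz_c Y) (hz_c Z))
     (block_mx (hz_Ac Y) 0 0 (hz_Ac Z)) (block_mx (hz_Ab Y) 0 0 (hz_Ab Z))
     (col_mx (hz_b Y) (hz_b Z)).

(* The only point of R^0, without factors or constraints: the unit of
   [hz_prod]. *)
Definition hz_unit (R : realType) : hz R 0 :=
  @HZ R 0 0 0 0 0 0 0 0 0 0.

Fixpoint hz_power (R : realType) (N : nat) (Z : hz R N) (p : nat) :
    hz R (p * N) :=
  match p return hz R (p * N) with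
  | 0%N => hz_unit R
  | q.+1 => hz_prod Z (hz_power Z q)
  end.

(* Generalized intersection of Y and Z along T; the factors of Z come first. *)
Definition hz_inter (R : realType) (M N : nat) (T : 'M[R]_(M, N))
    (Y : hz R N) (Z : hz R M) : hz R N :=
  HZ (row_mx (0 : 'M_(N, hz_ng Z)) (hz_Gc Y))
     (row_mx (0 : 'M_(N, hz_nb Z)) (hz_Gb Y))
     (hz_c Y)
     (col_mx (block_mx (hz_Ac Z) 0 0 (hz_Ac Y))
             (row_mx (- hz_Gc Z) (T *m hz_Gc Y)))
     (col_mx (block_mx (hz_Ab Z) 0 0 (hz_Ab Y))
             (row_mx (- hz_Gb Z) (T *m hz_Gb Y)))
     (col_mx (col_mx (hz_b Z) (hz_b Y)) (hz_c Z - T *m hz_c Y)).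

Definition mx_of_rows (R : realType) (m n : nat) (s : seq (seq R)) :
    'M[R]_(m, n) :=
  \matrix_(i, j) (nth [::] s i)`_j.

Definition hz_relu (R : realType) (alpha beta : R) : hz R 2 :=
  @HZ R 2 6 1 4
    (mx_of_rows 2 6 [:: [:: alpha / 2; beta / 2; 0; 0; 0; 0];
                        [:: 0;         beta / 2; 0; 0; 0; 0]])
    (mx_of_rows 2 1 [:: [:: - ((alpha + beta) / 4)];
                        [:: - (beta / 4)]])
    (mx_of_rows 2 1 [:: [:: (beta - alpha) / 4];
                        [:: beta / 4]])
    (mx_of_rows 4 6 [:: [:: 1;  0;  1; 0; 0; 0];
                        [:: -1; 0;  0; 1; 0; 0];
                        [:: 0;  1;  0; 0; 1; 0];
                        [:: 0;  -1; 0; 0; 0; 1]])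
    (mx_of_rows 4 1 [:: [:: 1 / 2]; [:: 1 / 2]; [:: - (1 / 2)]; [:: - (1 / 2)]])
    (mx_of_rows 4 1 [:: [:: 1 / 2]; [:: 1 / 2]; [:: 1 / 2]; [:: 1 / 2]]).

Definition relu (R : realType) (N : nat) (x : 'cV[R]_N) : 'cV[R]_N :=
  map_mx (fun z => Num.max z 0) x.

(* In the rest of the file, a network with l = L.+1 >= 1 layers has widths
   d 0, ..., d L.+1, and its k-th weight and bias (0 <= k <= L) are W k and
   v k.  The values of d, W and v at larger indices are never used. *)

Fixpoint nn_layer (R : realType) (d : nat -> nat)
    (W : forall k, 'M[R]_(d k.+1, d k)) (v : forall k, 'cV[R]_(d k.+1))
    (x : 'cV[R]_(d 0%N)) (k : nat) : 'cV[R]_(d k) :=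
  match k return 'cV[R]_(d k) with
  | 0%N => x
  | j.+1 => relu (W j *m nn_layer W v x j + v j)
  end.

Definition nn (R : realType) (d : nat -> nat)
    (W : forall k, 'M[R]_(d k.+1, d k)) (v : forall k, 'cV[R]_(d k.+1))
    (L : nat) (x : 'cV[R]_(d 0%N)) : 'cV[R]_(d L.+1) :=
  W L *m nn_layer W v x L + v L.

(* P = [e_1 e_3 ... e_(2p-1) e_2 e_4 ... e_(2p)]^T; indices start at 0 here.
   Both p + p and p * 2 stand for 2p. *)
Definition deinterleave_mx (R : realType) (p : nat) : 'M[R]_(p + p, p * 2) :=
  col_mx (\matrix_(i < p, j < p * 2) (j == i.*2 :> nat)%:R)
         (\matrix_(i < p, j < p * 2) (j == i.*2.+1 :> nat)%:R).

Definition gs_graph (R : realType) (alpha beta : R) (p : nat) (Z : hz R p) :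
    hz R (p + p) :=
  hz_inter (row_mx 1%:M 0)
    (hz_affine (deinterleave_mx R p) (hz_power (hz_relu alpha beta) p) 0) Z.

Fixpoint gs_X (R : realType) (d : nat -> nat)
    (W : forall k, 'M[R]_(d k.+1, d k)) (v : forall k, 'cV[R]_(d k.+1))
    (alpha beta : R) (X : hz R (d 0%N)) (k : nat) : hz R (d k) :=
  match k return hz R (d k) with
  | 0%N => X
  | j.+1 =>
    hz_affine (row_mx 0 1%:M)
      (gs_graph alpha beta (hz_affine (W j) (gs_X W v alpha beta X j) (v j))) 0
  end.

Definition gs_Z (R : realType) (d : nat -> nat)
    (W : forall k, 'M[R]_(d k.+1, d k)) (v : forall k, 'cV[R]_(d k.+1))
    (alpha beta : R) (X : hz R (d 0%N)) (k : nat) : hz R (d k.+1) :=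
  hz_affine (W k) (gs_X W v alpha beta X k) (v k).

(* [G 0] with p columns in total, for p >= q (see [pad_colsE]).  It is written
   as a product because in [gs_output] the difference p - q is not available
   as an explicit summand of p. *)
Definition pad_cols (R : realType) (n q p : nat) (G : 'M[R]_(n, q)) :
    'M[R]_(n, p) :=
  G *m pid_mx q.

Lemma pad_colsE (R : realType) (n q r : nat) (G : 'M[R]_(n, q)) :
  pad_cols (q + r) G = row_mx G 0.
Proof. by rewrite /pad_cols pid_mx_row mul_mx_row mulmx1 mulmx0. Qed.

(* [gs_Z] at L is the last affine layer, with no activation. *)
Definition gs_output (R : realType) (d : nat -> nat)
    (W : forall k, 'M[R]_(d k.+1, d k)) (v : forall k, 'cV[R]_(d k.+1))
    (L : nat) (alpha beta : R) (X : hz R (d 0%N)) :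
    hz R (d 0%N + d L.+1) :=
  let Y := gs_Z W v alpha beta X L in
  HZ (col_mx (pad_cols (hz_ng Y) (hz_Gc X)) (hz_Gc Y))
     (col_mx (pad_cols (hz_nb Y) (hz_Gb X)) (hz_Gb Y))
     (col_mx (hz_c X) (hz_c Y))
     (hz_Ac Y) (hz_Ab Y) (hz_b Y).

Definition graph_set (R : realType) (n m : nat)
    (f : 'cV[R]_n -> 'cV[R]_m) (S : set 'cV[R]_n) : set 'cV[R]_(n + m) :=
  [set z | exists x u, [/\ z = col_mx x u, u = f x & S x]].

(* Main.v *)
(* Each intersection of the algorithm lists the factors of Z first, so the
   factors of X remain the leading factors of every X^(k).  An admissible
   choice of factors of X^(k) therefore restricts to one of X, and its point is
   the k-th layer evaluated at the point of X so obtained; conversely, every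
   admissible choice for X extends to one for X^(k).  One layer preserves this
   because the power of H, with its coordinates deinterleaved, is the graph of
   ReLU over the box that contains Z. *)
Require Import Defs.
From mathcomp Require Import all_boot all_order all_algebra.
From mathcomp Require Import classical_sets reals.
From mathcomp Require Import ring lra.
Import Order.TTheory GRing.Theory Num.Theory.
Local Open Scope classical_set_scope.
Local Open Scope ring_scope.

(** * Admissible factors, and how the operations act on them *)

Definition in_unit_itv (R : realType) (x : R) : Prop := -1 <= x <= 1.

Definition is_sign (R : realType) (x : R) : Prop := x = -1 \/ x = 1.

(** Feasibility is kept apart from the point produced, because later arguments compare the factors
    of different representations. *)
Definition hz_feasible (R : realType) (N : nat) (Z : hz R N)
    (xc : 'cV[R]_(hz_ng Z)) (xb : 'cV[R]_(hz_nb Z)) : Prop :=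
  [/\ forall i, in_unit_itv R (xc i 0),
      forall i, is_sign R (xb i 0)
    & hz_Ac Z *m xc + hz_Ab Z *m xb = hz_b Z].

Definition hz_point (R : realType) (N : nat) (Z : hz R N)
    (xc : 'cV[R]_(hz_ng Z)) (xb : 'cV[R]_(hz_nb Z)) : 'cV[R]_N :=
  hz_Gc Z *m xc + hz_Gb Z *m xb + hz_c Z.

Arguments hz_feasible {R N} Z xc xb.
Arguments hz_point {R N} Z xc xb.

Lemma hz_setP (R : realType) (N : nat) (Z : hz R N) (z : 'cV[R]_N) :
  hz_set Z z <-> exists xc xb, hz_feasible Z xc xb /\ z = hz_point Z xc xb.
Proof.
split=> [[xc [xb [? ? ? ?]]]|[xc [xb [[? ? ?] ?]]]]; exists xc, xb => //.
Qed.

Lemma forall_col_mx (R : Type) (m n : nat) (P : R -> Prop)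
    (x : 'cV[R]_m) (y : 'cV[R]_n) :
  (forall i, P (col_mx x y i 0)) <->
  (forall i, P (x i 0)) /\ (forall i, P (y i 0)).
Proof.
split=> [Pxy|[Px Py] i].
  split=> i; first by have := Pxy (lshift n i); rewrite col_mxEu.
  by have := Pxy (rshift m i); rewrite col_mxEd.
by case: (split_ordP i) => j ->; rewrite (col_mxEu, col_mxEd).
Qed.

Lemma hz_point_affine (R : realType) (M N : nat) (W : 'M[R]_(M, N)) Z v xc xb :
  hz_point (hz_affine W Z v) xc xb = W *m hz_point Z xc xb + v.
Proof. by rewrite /hz_point /= !mulmxDr !mulmxA addrA. Qed.

Lemma hz_set_affine (R : realType) (M N : nat) (W : 'M[R]_(M, N)) Z v :
  hz_set (hz_affine W Z v) = [set W *m z + v | z in hz_set Z].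
Proof.
apply/seteqP; split=> y.
  case/hz_setP=> xc [xb [f ->]]; exists (hz_point Z xc xb).
    by apply/hz_setP; exists xc, xb.
  by rewrite hz_point_affine.
case=> z /hz_setP[xc [xb [f ->]]] <-; apply/hz_setP; exists xc, xb.
by rewrite hz_point_affine.
Qed.

Section Product.
Variables (R : realType) (M N : nat) (Y : hz R M) (Z : hz R N).

Lemma hz_feasible_prod yc zc yb zb :
  hz_feasible (hz_prod Y Z) (col_mx yc zc) (col_mx yb zb) <->
  hz_feasible Y yc yb /\ hz_feasible Z zc zb.
Proof.
rewrite /hz_feasible /= !mul_block_col !mul0mx !addr0 !add0r add_col_mx.
split.
  case=> /(forall_col_mx R _ _ (in_unit_itv R))[? ?].
  by move=> /(forall_col_mx R _ _ (is_sign R))[? ?] /eq_col_mx[].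
case=> -[? ? ->] [? ? ->]; split=> //.
  exact/(forall_col_mx R _ _ (in_unit_itv R)).
exact/(forall_col_mx R _ _ (is_sign R)).
Qed.

Lemma hz_point_prod yc zc yb zb :
  hz_point (hz_prod Y Z) (col_mx yc zc) (col_mx yb zb) =
  col_mx (hz_point Y yc yb) (hz_point Z zc zb).
Proof.
by rewrite /hz_point /= !mul_block_col !mul0mx !addr0 !add0r !add_col_mx.
Qed.

Lemma hz_set_prod y z :
  hz_set (hz_prod Y Z) (col_mx y z) <-> hz_set Y y /\ hz_set Z z.
Proof.
split=> [/hz_setP|].
  case=> [xc [xb]]; rewrite -[xc]vsubmxK -[xb]vsubmxK hz_point_prod.
  move=> [/hz_feasible_prod[fY fZ]] /eq_col_mx[-> ->].
  by split; apply/hz_setP; do 2!eexists; split; eauto.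
case=> /hz_setP[yc [yb [fY ->]]] /hz_setP[zc [zb [fZ ->]]].
apply/hz_setP; exists (col_mx yc zc), (col_mx yb zb).
by rewrite hz_point_prod hz_feasible_prod.
Qed.

End Product.

Section Intersection.
Variables (R : realType) (M N : nat) (T : 'M[R]_(M, N)).
Variables (Y : hz R N) (Z : hz R M).

(** The last block row of constraints, with its negated terms moved across, says that [T] sends the
    point of [Y] to that of [Z]. *)
Lemma hz_feasible_inter zc yc zb yb :
  hz_feasible (hz_inter T Y Z) (col_mx zc yc) (col_mx zb yb) <->
  [/\ hz_feasible Z zc zb, hz_feasible Y yc yb
    & T *m hz_point Y yc yb = hz_point Z zc zb].
Proof.
rewrite /hz_feasible /hz_point /=.
rewrite !mul_col_mx !mul_row_col !mul0mx !addr0 !add0r.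
rewrite !add_col_mx.
have moveE (p q r s : 'cV[R]_M) : - p + q = r - s <-> q + s = p + r.
  by split=> E; [rewrite -[q](addNKr p) E -addrA subrK
                |rewrite -[q](addrK s) E -addrA addKr].
have eqT : - hz_Gc Z *m zc + T *m hz_Gc Y *m yc +
           (- hz_Gb Z *m zb + T *m hz_Gb Y *m yb) = hz_c Z - T *m hz_c Y <->
           T *m (hz_Gc Y *m yc + hz_Gb Y *m yb + hz_c Y) =
           hz_Gc Z *m zc + hz_Gb Z *m zb + hz_c Z.
  by rewrite !mulmxDr !mulmxA !mulNmx addrACA -opprD moveE.
split.
  case=> /(forall_col_mx R _ _ (in_unit_itv R))[? ?].
  move=> /(forall_col_mx R _ _ (is_sign R))[? ?].
  by case/eq_col_mx=> /eq_col_mx[? ?] /eqT.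
case=> -[? ? ->] [? ? ->] /eqT->; split=> //.
  exact/(forall_col_mx R _ _ (in_unit_itv R)).
exact/(forall_col_mx R _ _ (is_sign R)).
Qed.

Lemma hz_point_inter zc yc zb yb :
  hz_point (hz_inter T Y Z) (col_mx zc yc) (col_mx zb yb) = hz_point Y yc yb.
Proof. by rewrite /hz_point /= !mul_row_col !mul0mx !add0r. Qed.

End Intersection.

(** * Cartesian powers, block by block *)

Lemma block_ord_subproof (p N : nat) (i : 'I_p) (j : 'I_N) :
  (i * N + j < p * N)%N.
Proof.
apply: (@leq_trans (i.+1 * N)); last by rewrite leq_mul2r ltn_ord orbT.
by rewrite mulSn addnC ltn_add2r.
Qed.

Definition block_ord (p N : nat) (i : 'I_p) (j : 'I_N) : 'I_(p * N) :=
  Ordinal (block_ord_subproof p N i j).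
Arguments block_ord {p N}.

Lemma hz_set_power (R : realType) (N : nat) (Z : hz R N) (p : nat)
    (z : 'cV[R]_(p * N)) :
  hz_set (hz_power Z p) z <->
  forall i, hz_set Z (\col_j z (block_ord i j) 0).
Proof.
elim: p z => [|p IHp] z.
  split=> [_ []//|_]; exists 0, 0.
  by split=> [[]|[]||] //; apply/matrixP; case.
rewrite [hz_power _ _]/=.
rewrite -[z](@vsubmxK _ N (p * N) 1).
move: (usubmx _) (dsubmx _) => u w.
rewrite hz_set_prod IHp.
have E0 : \col_j (col_mx u w : 'cV_(p.+1 * N)) (block_ord ord0 j) 0 = u.
  apply/matrixP=> j k; rewrite ord1 mxE -(col_mxEu u w); congr (col_mx u w _ _).
  exact: val_inj.
have ES i : \col_j (col_mx u w : 'cV_(p.+1 * N)) (block_ord (lift ord0 i) j) 0 =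
            \col_j w (block_ord i j) 0.
  apply/matrixP=> j k; rewrite ord1 mxE [RHS]mxE -(col_mxEd u w).
  congr (col_mx u w _ _).
  by apply: val_inj; rewrite /= /bump /= add1n mulSn addnA.
split=> [[Zu Zw] i|Zall].
  by case: (unliftP ord0 i) => [j ->|->]; rewrite ?E0 ?ES.
split=> [|i]; first by have := Zall ord0; rewrite E0.
by have := Zall (lift ord0 i); rewrite ES.
Qed.

(** * The graph of ReLU as a hybrid zonotope *)

Lemma segment_param (R : realType) (a t : R) :
  0 < a -> 0 <= t <= a -> exists2 x, -1 <= x <= 1 & t = a / 2 * (x + 1).
Proof.
move=> a0 /andP[t0 ta]; exists (2 * (t / a) - 1); last first.
  by field; rewrite gt_eqF.
have : 0 <= t / a by rewrite divr_ge0 // ltW.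
have : t / a <= 1 by rewrite ler_pdivrMr // mul1r.
lra.
Qed.

Lemma ord2P (i : 'I_2) : i = 0 \/ i = 1.
Proof. by case: i => -[|[|[]]] // ?; [left|right]; apply: val_inj. Qed.

Lemma hz_set_relu (R : realType) (alpha beta : R) (w : 'cV[R]_2) :
  0 < alpha -> 0 < beta ->
  hz_set (hz_relu alpha beta) w <->
  - alpha <= w 0 0 <= beta /\ w 1 0 = Num.max (w 0 0) 0.
Proof.
move=> alpha0 beta0; split=> [[xc [xb [xcP xbP /matrixP xE ->]]]|].
  have := xE 0 0; have := xE 1 0; have := xE 2 0; have := xE 3 0.
  (* The indices are iterated [lift ord0], the form in which [big_ord_recl] expands the sums. *)
  have xcS i : -1 <= xc (lift ord0 i) 0 <= 1 by exact: xcP.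
  have := xcP ord0; have := xcS ord0; have := xcS (lift ord0 ord0).
  have := xcS (lift ord0 (lift ord0 ord0)).
  have := xcS (lift ord0 (lift ord0 (lift ord0 ord0))).
  have := xcS (lift ord0 (lift ord0 (lift ord0 (lift ord0 ord0)))).
  have := xbP ord0.
  rewrite /hz_relu /= !mxE !(big_ord_recl, big_ord0) /= !mxE /=.
  move: (xb _ _) (xc _ _) (xc _ _) (xc _ _) (xc _ _) (xc _ _) (xc _ _).
  move=> s x1 x2 x3 x4 x5 x6 sP x1P x2P x3P x4P x5P x6P e4 e3 e2 e1.
  (* The slack equations force x1 = 0 when s = -1 and x2 = 0 when s = 1, so the
     two signs give the two linear pieces of ReLU. *)
  case: sP => ss; subst s.
    have x10 : x1 = 0 by lra.
    (* The bounds on [x2] are multiplied by [beta] beforehand, since [lra] treats [beta * x2] as an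
       atom. *)
    have x20 : 0 <= beta * (x2 + 1) by rewrite mulr_ge0; lra.
    have x2b : 0 <= beta * (1 - x2) by rewrite mulr_ge0; lra.
    by rewrite x10 max_l; lra.
  have x20 : x2 = 0 by lra.
  have x10 : 0 <= alpha * (x1 + 1) by rewrite mulr_ge0; lra.
  have x1a : 0 <= alpha * (1 - x1) by rewrite mulr_ge0; lra.
  by rewrite x20 max_r; lra.
case=> /andP[wa wb] w1E.
have [w0|/ltW w0] := leP 0 (w 0 0).
  have [|x xP wE] := @segment_param _ beta (w 0 0) beta0; first by lra.
  rewrite max_l // in w1E.
  (* With sign -1 the first factor is 0, the second runs along the segment from 0 to [beta], and the
     four slacks are solved from the constraints. *)
  exists (\col_i [:: 0; x; 1; 1; - x; x]`_i), (const_mx (-1)).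
  split=> [i|i||].
  + by rewrite mxE; case: i => -[|[|[|[|[|[|[]]]]]]] //= _; lra.
  + by rewrite mxE; left.
  + apply/matrixP=> i j; rewrite ord1 !mxE !(big_ord_recl, big_ord0) /= !mxE.
    by case: i => -[|[|[|[|[]]]]] //= _; lra.
  apply/matrixP=> i j; rewrite ord1 !mxE !(big_ord_recl, big_ord0) /= !mxE.
  case: (ord2P i) => ->.
    by rewrite wE /=; lra.
  by rewrite w1E wE /=; lra.
(* The negative piece is parametrized through [- w 0 0], hence the first factor [- x] in the
   witness; the sign is now 1. *)
have [|x xP wE] := @segment_param _ alpha (- w 0 0) alpha0; first by lra.
rewrite max_r // in w1E.
exists (\col_i [:: - x; 0; x; - x; 1; 1]`_i), (const_mx 1).
split=> [i|i||].
+ by rewrite mxE; case: i => -[|[|[|[|[|[|[]]]]]]] //= _; lra.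
+ by rewrite mxE; right.
+ apply/matrixP=> i j; rewrite ord1 !mxE !(big_ord_recl, big_ord0) /= !mxE.
  by case: i => -[|[|[|[|[]]]]] //= _; lra.
apply/matrixP=> i j; rewrite ord1 !mxE !(big_ord_recl, big_ord0) /= !mxE.
case: (ord2P i) => ->.
  by rewrite -[w 0 0]opprK wE /=; lra.
by rewrite w1E /=; lra.
Qed.

(** Each row of the matrix has a single 1, in column 2i or 2i+1, so each sum collapses to one
    term. *)
Lemma deinterleave_mxE (R : realType) (p : nat) (w : 'cV[R]_(p * 2)) :
  deinterleave_mx R p *m w =
  col_mx (\col_i w (block_ord i 0) 0) (\col_i w (block_ord i 1) 0).
Proof.
have sumE (i : 'I_p) (t : 'I_2) (k : nat) : k = block_ord i t ->
    \sum_(j < p * 2) (j == k :> nat)%:R * w j 0 = w (block_ord i t) 0.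
  move=> ->; rewrite (bigD1 (block_ord i t)) //= eqxx mul1r big1 ?addr0 // => j.
  by rewrite -val_eqE /= => /negPf->; rewrite mul0r.
rewrite mul_col_mx; congr col_mx; apply/matrixP=> i j; rewrite ord1 !mxE.
  rewrite -(@sumE _ _ i.*2) /= ?muln2 ?addn0 //.
  by apply: eq_bigr => k _; rewrite mxE.
rewrite -(@sumE _ _ i.*2.+1) /= ?muln2 ?addn1 //.
by apply: eq_bigr => k _; rewrite mxE.
Qed.

Lemma hz_set_relu_graph (R : realType) (alpha beta : R) (p : nat)
    (z y : 'cV[R]_p) : 0 < alpha -> 0 < beta ->
  hz_set (hz_affine (deinterleave_mx R p) (hz_power (hz_relu alpha beta) p) 0)
    (col_mx z y) <->
  (forall i, - alpha <= z i 0 <= beta) /\ y = relu z.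
Proof.
move=> alpha0 beta0; rewrite hz_set_affine; split.
  case=> w /hz_set_power wP; rewrite addr0 deinterleave_mxE.
  case/eq_col_mx=> <- <-.
  have {}wP i := (hz_set_relu _ _ _ _ alpha0 beta0).1 (wP i).
  split=> [i|]; first by have [] := wP i; rewrite !mxE.
  by apply/matrixP=> i j; have [_] := wP i; rewrite !mxE.
case=> zP ->.
(* In the interleaved preimage, coordinate [s] lies in block [s./2], and its parity tells input from
   output. *)
have half_lt (s : 'I_(p * 2)) : (s./2 < p)%N.
  by rewrite ltn_half_double -muln2.
have halfE i t : Ordinal (half_lt (block_ord i t)) = i.
  apply: val_inj; rewrite /= muln2.
  by case: (ord2P t) => ->; rewrite /= ?addn0 ?addn1 /= ?doubleK ?uphalf_double.
have [w [w0 w1]] : exists w : 'cV[R]_(p * 2),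
    (forall i, w (block_ord i 0) 0 = z i 0) /\
    (forall i, w (block_ord i 1) 0 = relu z i 0).
  exists (\col_s (if odd s then relu z else z) (Ordinal (half_lt s)) 0).
  split=> i; rewrite mxE halfE /=; first by rewrite addn0 muln2 odd_double.
  by rewrite addn1 muln2 /= odd_double.
exists w.
  apply/hz_set_power=> i; apply/hz_set_relu=> //.
  by rewrite !mxE w0 w1 mxE.
rewrite addr0 deinterleave_mxE; congr col_mx; apply/matrixP=> i j.
  by rewrite ord1 mxE w0.
by rewrite ord1 mxE w1.
Qed.

(** * Lifting factors of the input set through the layers *)

(* The matrices [pid_mx] keep the leading factors of Y, which are those of X.
   Equality of sets would not suffice: the output combines generators of X and
   of the last layer that act on the same factors. *)
Definition hz_lifts (R : realType) (n m : nat) (X : hz R n) (Y : hz R m)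
    (f : 'cV[R]_n -> 'cV[R]_m) : Prop :=
  [/\ (hz_ng X <= hz_ng Y)%N, (hz_nb X <= hz_nb Y)%N,
      forall yc yb, hz_feasible Y yc yb ->
        hz_feasible X (pid_mx (hz_ng X) *m yc) (pid_mx (hz_nb X) *m yb) /\
        hz_point Y yc yb =
        f (hz_point X (pid_mx (hz_ng X) *m yc) (pid_mx (hz_nb X) *m yb))
    & forall xc xb, hz_feasible X xc xb ->
        exists yc yb, [/\ hz_feasible Y yc yb, pid_mx (hz_ng X) *m yc = xc
                        & pid_mx (hz_nb X) *m yb = xb]].
Arguments hz_lifts {R n m} X Y f.

Lemma hz_lifts_affine (R : realType) (n m : nat) (X : hz R n)
    (W : 'M[R]_(m, n)) (v : 'cV[R]_m) :
  hz_lifts X (hz_affine W X v) (fun x => W *m x + v).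
Proof.
split=> // [yc yb fY|xc xb fX].
  by rewrite !pid_mx_1 !mul1mx hz_point_affine.
by exists xc, xb; rewrite !pid_mx_1 !mul1mx.
Qed.

Lemma hz_lifts_id (R : realType) (n : nat) (X : hz R n) : hz_lifts X X id.
Proof.
split=> // [yc yb fY|xc xb fX]; first by rewrite !pid_mx_1 !mul1mx.
by exists xc, xb; rewrite !pid_mx_1 !mul1mx.
Qed.

Lemma hz_lifts_trans (R : realType) (n m p : nat) (X : hz R n) (Y : hz R m)
    (Z : hz R p) f g :
  hz_lifts X Y f -> hz_lifts Y Z g -> hz_lifts X Z (g \o f).
Proof.
case=> ngXY nbXY XY YX [ngYZ nbYZ YZ ZY].
(* Keeping the first [b] factors and then the first [a] of these is keeping the first [a] at
   once. *)
have pidE a b c (z : 'cV[R]_c) : (a <= b)%N ->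
    pid_mx a *m z = pid_mx a *m ((pid_mx b : 'M_(b, c)) *m z) :> 'cV_a.
  by move=> leab; rewrite mulmxA mul_pid_mx (minn_idPl leab) (minn_idPr leab).
split=> [||zc zb /YZ[/XY[? fE] gE]|xc xb].
- exact: leq_trans ngXY ngYZ.
- exact: leq_trans nbXY nbYZ.
- by rewrite gE fE (pidE _ _ _ zc ngXY) (pidE _ _ _ zb nbXY).
case/YX=> yc [yb [/ZY[zc [zb [? zcE zbE]]] <- <-]].
by exists zc, zb; rewrite -zcE -zbE -!pidE.
Qed.

(** The intersection constraint identifies the input half of the point of H with the point of [Z],
    so the output half is its ReLU. The box puts every point of [Z] in the domain of that graph, so
    every feasible choice for [Z] extends. *)
Lemma hz_lifts_relu (R : realType) (alpha beta : R) (p : nat) (Z : hz R p) :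
  0 < alpha -> 0 < beta ->
  (forall z, hz_set Z z -> forall i, - alpha <= z i 0 <= beta) ->
  hz_lifts Z (hz_affine (row_mx 0 1%:M) (gs_graph alpha beta Z) 0) (@relu R p).
Proof.
move=> alpha0 beta0 Zbox.
rewrite /gs_graph; set H := hz_affine (deinterleave_mx R p) _ 0.
split; [exact: leq_addr|exact: leq_addr| |].
  move=> gc gb.
  (* The factors are cut where those of [Z] end and those of H begin; [pid_mx] keeps the first
     part. *)
  rewrite -[gc](@vsubmxK _ (hz_ng Z) (hz_ng H) 1).
  rewrite -[gb](@vsubmxK _ (hz_nb Z) (hz_nb H) 1).
  move: (usubmx gc) (dsubmx gc) (usubmx gb) (dsubmx gb) => zc yc zb yb.
  case/hz_feasible_inter=> fZ fH.
  rewrite hz_point_affine hz_point_inter !pid_mx_row !mul_row_col !mul1mx.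
  rewrite !mul0mx !addr0 => HZ; split=> //.
  have : hz_set H (hz_point H yc yb) by apply/hz_setP; exists yc, yb.
  move: HZ; rewrite -[hz_point H yc yb]vsubmxK !mul_row_col.
  rewrite !mul1mx !mul0mx addr0 add0r => <-.
  by case/hz_set_relu_graph=> // _ ->.
move=> zc zb fZ; set z := hz_point Z zc zb.
have Zz : hz_set Z z by apply/hz_setP; exists zc, zb.
have : hz_set H (col_mx z (relu z)).
  by apply/hz_set_relu_graph=> //; split=> //; apply: Zbox.
case/hz_setP=> yc [yb [fH zE]].
exists (col_mx zc yc), (col_mx zb yb); split.
- apply/hz_feasible_inter; split=> //.
  by rewrite -zE mul_row_col mul1mx mul0mx addr0.
- by rewrite pid_mx_row mul_row_col mul1mx mul0mx addr0.
by rewrite pid_mx_row mul_row_col mul1mx mul0mx addr0.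
Qed.

Lemma hz_lifts_gs_X (R : realType) (d : nat -> nat)
    (W : forall k, 'M[R]_(d k.+1, d k)) (v : forall k, 'cV[R]_(d k.+1))
    (X : hz R (d 0%N)) (alpha beta : R) (k : nat) :
  0 < alpha -> 0 < beta ->
  (forall j, (j < k)%N -> forall z, hz_set (gs_Z W v alpha beta X j) z ->
     forall i, - alpha <= z i 0 <= beta) ->
  hz_lifts X (gs_X W v alpha beta X k) (fun x => nn_layer W v x k).
Proof.
move=> alpha0 beta0; elim: k => [_|k IHk Zbox]; first exact: hz_lifts_id.
(* A layer is an affine lift to [gs_Z] followed by a ReLU lift; the box needed is that of index
   [k]. *)
apply: (hz_lifts_trans _ _ _ _ _ (gs_Z W v alpha beta X k) _
  (fun x => W k *m nn_layer W v x k + v k) (@relu R _)); last first.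
  by apply: hz_lifts_relu => //; apply: Zbox.
apply: (hz_lifts_trans _ _ _ _ _ _ _ (fun x => nn_layer W v x k)
  (fun x => W k *m x + v k)); last exact: hz_lifts_affine.
by apply: IHk => j /ltnW; apply: Zbox.
Qed.

Theorem theorem1 (R : realType) (L : nat) (d : nat -> nat)
  (W : forall k, 'M[R]_(d k.+1, d k)) (v : forall k, 'cV[R]_(d k.+1))
  (X : hz R (d 0%N)) (alpha beta : R)
  (alpha_gt0 : 0 < alpha) (beta_gt0 : 0 < beta)
  (Z_bounded : forall k, (k < L)%N ->
     hz_set (gs_Z W v alpha beta X k) `<=`
       [set z : 'cV[R]_(d k.+1) | forall i, - alpha <= z i 0 <= beta]) :
  is_hybrid_zonotope (hz_set (gs_output W v L alpha beta X)) /\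
  hz_set (gs_output W v L alpha beta X) = graph_set (nn W v L) (hz_set X).
Proof.
split; first by eexists.
have Zbox j (jL : (j < L)%N) z := Z_bounded j jL z.
(* The hidden layers are followed by one more affine lift, whose composite with them is
   [nn W v L]. *)
have [ngXY nbXY YX XY] := hz_lifts_trans _ _ _ _ _ _ _ _ _
  (hz_lifts_gs_X _ _ W v X _ _ L alpha_gt0 beta_gt0 Zbox)
  (hz_lifts_affine _ _ _ (gs_X W v alpha beta X L) (W L) (v L)).
pose O := gs_output W v L alpha beta X.
pose Y := gs_Z W v alpha beta X L.
(* Padding generators of [X] with zero columns amounts to truncating the factors: the [pid_mx] in
   [pad_cols] passes to the factors by associativity. *)
have pointE yc yb : hz_point O yc yb =
    col_mx (hz_point X (pid_mx (hz_ng X) *m yc) (pid_mx (hz_nb X) *m yb))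
           (hz_point Y yc yb).
  by rewrite /hz_point /= !mul_col_mx !add_col_mx -!mulmxA.
apply/seteqP; split=> z.
  (* The output has the constraints of [Y], so feasibility for one is feasibility for the other. *)
  case/hz_setP=> yc [yb [/YX[fX uE] ->]]; rewrite pointE uE.
  set x := hz_point X _ _; exists x, (nn W v L x); split=> //.
  by apply/hz_setP; do 2!eexists; split; first exact: fX.
case=> x [u [-> -> /hz_setP[xc [xb [/XY[yc [yb [fY xcE xbE]]] ->]]]]].
apply/hz_setP; exists yc, yb; split=> //; rewrite pointE.
(* The extended factors restrict to [xc] and [xb], so both halves of the output point come from the
   same [x]. *)
by have [_ ->] := YX _ _ fY; rewrite xcE xbE.
Qed.
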